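(* Let $s \ge 4$ be even and let $X$ be an antipodal $s$-distance set in the unit sphere $S^{d-1}\subset\mathbb{R}^d$ with $B(X) = \{-1, \beta_1 = 0, \pm\beta_2, \ldots, \pm\beta_{s/2}\}$ (a set of exactly $s$ elements). (1) Let $N = \binom{d+s-3}{s-2}$. If $|X| \ge 4N$, then for each $i = 1, \ldots, s/2$ the number \[ k_i = \prod_{j=1,\ldots,s/2,\ j \neq i} \frac{1 - \beta_j^2}{\beta_i^2 - \beta_j^2} \] is an integer, and $|k_i| \le U(N)$. (2) Let $N = \binom{d+s-4}{s-3}$. If $|X| \ge 4N + 2$, then for each $i = 2, \ldots, s/2$ the number \[ k_i = \frac{1}{\beta_i} \prod_{j=2,\ldots,s/2,\ j \neq i} \frac{1 - \beta_j^2}{\beta_i^2 - \beta_j^2} \] is an integer, and $|k_i| \le \left\lfloor \sqrt{2N^2/(N+1)} \right\rfloor$.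
   Context: A finite set $X \subset \mathbb{R}^d$ is an $s$-distance set if the set of Euclidean distances between distinct points of $X$ has exactly $s$ elements. $X$ is antipodal if $-x \in X$ for every $x \in X$. For $X \subset S^{d-1}$, $B(X) = \{(x,y) : x, y \in X, x \neq y\}$, where $(\cdot,\cdot)$ is the standard inner product. The function $U$ is defined by $U(N) = \left\lfloor \frac{1}{2} + \sqrt{\frac{N^2}{2N-2} + \frac{1}{4}} \right\rfloor$. *)

(* Defs.v *)
From HB Require Import structures.
From mathcomp Require Import all_boot all_order all_algebra.
From mathcomp Require Import reals.
Set Implicit Arguments. Unset Strict Implicit. Unset Printing Implicit Defensive.
Import Order.TTheory GRing.Theory Num.Theory.
Local Open Scope ring_scope.

Section Defs.
Variables (R : realType) (d : nat).

Definition inprod (u v : 'rV[R]_d) : R := \sum_(i < d) u 0 i * v 0 i.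

Definition edist (u v : 'rV[R]_d) : R := Num.sqrt (inprod (u - v) (u - v)).

(** X (a duplicate-free list of points) lies on the unit sphere S^{d-1} *)
Definition on_unit_sphere (X : seq 'rV[R]_d) : Prop :=
  forall x, x \in X -> inprod x x = 1.

Definition antipodal (X : seq 'rV[R]_d) : Prop :=
  forall x, x \in X -> - x \in X.

Definition distances (X : seq 'rV[R]_d) : seq R :=
  undup [seq edist x.1 x.2 | x <- [seq (x, y) | x <- X, y <- X] & x.1 != x.2].

Definition s_distance_set (X : seq 'rV[R]_d) (s : nat) : Prop :=
  size (distances X) = s.

Definition in_B (X : seq 'rV[R]_d) (t : R) : Prop :=
  exists x y, [/\ x \in X, y \in X, x != y & inprod x y = t].
End Defs.

Definition U (R : realType) (N : nat) : int :=
  Num.floor (2^-1 + Num.sqrt ((N ^ 2)%:R / (2 * N - 2)%:R + 4^-1) : R).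

Definition U2 (R : realType) (N : nat) : int :=
  Num.floor (Num.sqrt ((2 * N ^ 2)%:R / (N + 1)%:R) : R).

Definition k1 (R : realType) (beta : nat -> R) (m i : nat) : R :=
  \prod_(j <- iota 1 m | j != i)
     ((1 - beta j ^+ 2) / (beta i ^+ 2 - beta j ^+ 2)).

Definition k2 (R : realType) (beta : nat -> R) (m i : nat) : R :=
  (beta i)^-1 * \prod_(j <- iota 2 m.-1 | j != i)
     ((1 - beta j ^+ 2) / (beta i ^+ 2 - beta j ^+ 2)).

(* Main.v *)
Require Import Defs.
From HB Require Import structures.
From mathcomp Require Import all_boot all_order all_algebra.
From mathcomp Require Import boolp reals zify ring lra.
Import Order.TTheory GRing.Theory Num.Theory.
Local Open Scope ring_scope.

(** Let [Y] contain at most one point of each antipodal pair of [X]. Evaluating at [(x,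
    y)] the polynomial in the inner product that vanishes at every [beta_j] with [j !=
    i] and is normalised to take the value 1 at [beta_i] gives a matrix [M] over [Y]
    with constant diagonal [k_i] and off-diagonal entries 0 or 1 (even polynomial, part
    1), respectively 0 or +-1 (odd polynomial, part 2). On the sphere the polynomial is
    a form of degree [D = s - 2], respectively [D = s - 3], so the rank of [M] is at
    most the number [N] of monomials of degree [D]. Hence [- k_i] is an eigenvalue of
    the integer matrix [M - k_i I] of multiplicity at least [|Y| - N], which is at least
    half of [|Y|]; an irrational eigenvalue has a conjugate of the same multiplicity,
    which is impossible when [|Y| = 2N + 1] and, when [|Y| = 2N], forces [(M - k_i I)^2]
    to be scalar, so that [M - k_i I] is the adjacency matrix of a perfect matching or
    of an empty graph, whose eigenvalues are 0, 1 and -1.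
    The bounds on [|k_i|] come from the inequality [(tr S)^2 <= rank S * tr (S S^T)],
    applied to [S = 2 M - J] ([J] the all-one matrix) in part 1 and to [S = M] in part
    2. *)

(** * Minimal polynomials over the rationals and multiplicities of roots *)

Section MinPoly.
Variables (L : numFieldType) (a : L).
Implicit Types p q r : {poly rat}.
Local Notation "p ^L" := (map_poly (ratr : rat -> L) p) (at level 2, format "p ^L").

Lemma minimal_rat_poly p : p != 0 -> root p^L a ->
  exists q, [/\ q \is monic, root q^L a & forall r, root r^L a -> q %| r].
Proof.
move=> p0 pa; pose P n := `[< exists q, [/\ q != 0, root q^L a & size q = n] >].
have exP : exists n, P n by exists (size p); apply/asboolP; exists p.
case: (ex_minnP exP) => n /asboolP[q [q0 qa <-]] qmin.
have lq0 : lead_coef q != 0 by rewrite lead_coef_eq0.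
exists ((lead_coef q)^-1 *: q); split.
- by rewrite monicE lead_coefZ mulVf.
- by rewrite map_polyZ /= rootZ // fmorph_eq0 invr_eq0.
move=> r ra; rewrite dvdpZl ?invr_eq0 //.
apply/modp_eq0P/eqP/negPn/negP => rq0.
have : (size q <= size (r %% q)%R)%N.
  apply/qmin/asboolP; exists (r %% q); split => //.
  have : root (r %/ q * q + r %% q)^L a by rewrite -divp_eq.
  by rewrite /root rmorphD rmorphM !hornerE /= (eqP qa) mulr0 add0r.
by rewrite leqNgt ltn_modp q0.
Qed.

(** In characteristic 0 the derivative of [q] is nonzero and of smaller degree, so [a] is a simple
    root of [q]. Dividing [p] by [q] thus removes exactly one factor ['X - a%:P], which gives the
    induction on [m]. *)
Lemma minimal_rat_poly_pow q m p :
  q != 0 -> root q^L a -> (forall r, root r^L a -> q %| r) ->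
  ('X - a%:P) ^+ m %| p^L -> q ^+ m %| p.
Proof.
move=> q0 qa qmin; elim: m p => [|m IHm] p; first by rewrite !expr0 !dvd1p.
move=> mp.
have /qmin/dvdpP[p1 pE] : root p^L a.
  by rewrite -dvdp_XsubCl (dvdp_trans _ mp) // exprS dvdp_mulr.
have [q2 q2E] := factor_theorem _ _ qa.
have q2a : ~~ root q2 a.
  apply/negP => q2a.
  have : root (q^`())^L a.
    rewrite -deriv_map q2E derivM derivXsubC mulr1 /root !hornerE subrr mulr0.
    by rewrite add0r; exact: q2a.
  have q1 : (1 < size q)%N.
    by rewrite -(size_map_poly (ratr : {rmorphism rat -> L})) (root_size_gt1 _ qa) // map_poly_eq0.
  have q'0 : q^`() != 0.
    apply/eqP => /(congr1 (fun r => r`_(size q).-2)); rewrite coef_deriv coef0.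
    have -> : (size q).-2.+1 = (size q).-1 by case: (size q) q1 => [|[]].
    by move/eqP; rewrite mulrn_eq0 -lead_coefE lead_coef_eq0 (negPf q0) orbF; case: (size q) q1 => [|[]].
  by move=> /qmin/(dvdp_leq q'0); rewrite leqNgt lt_size_deriv.
rewrite exprSr pE dvdp_mul2r //; apply: IHm.
move: mp; rewrite pE rmorphM /= q2E mulrA exprSr dvdp_mul2r ?polyXsubC_eq0 //.
rewrite mulrC Gauss_dvdpr // coprimep_expl // coprimep_sym.
by rewrite coprimep_XsubC.
Qed.

(* The minimal polynomial [q] of [a] is separable, so [q ^+ m] divides [p]; it has
   degree at least 2 when [a] is irrational. *)
Lemma half_multiplicity_root p m : p \is monic -> (0 < m)%N ->
  ((size p).-1 <= m.*2)%N -> ('X - a%:P) ^+ m %| p^L ->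
  (exists c, a = ratr c) \/
  (size p).-1 = m.*2 /\ exists b, p^L = (('X - a%:P) * ('X - b%:P)) ^+ m.
Proof.
move=> pm m0 pn mp; have p0 := monic_neq0 pm.
have pa : root p^L a.
  by rewrite -dvdp_XsubCl (dvdp_trans _ mp) // -(prednK m0) exprS dvdp_mulr.
have [q [qm qa qmin]] := minimal_rat_poly _ p0 pa; have q0 := monic_neq0 qm.
have qmp := minimal_rat_poly_pow _ _ _ q0 qa qmin mp.
have q1 : (1 < size q)%N.
  by rewrite -(size_map_poly (ratr : {rmorphism rat -> L})) (root_size_gt1 _ qa) // map_poly_eq0.
have sqm : (size (q ^+ m)%R).-1 = ((size q).-1 * m)%N by rewrite size_exp.
have [q2|q3] := leqP (size q) 2.
  left; exists (- q`_0); have : size q = 2 by apply/eqP; rewrite eqn_leq q2.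
  move/eqP: qa; move=> + sq; rewrite horner_coef size_map_poly sq big_ord_recl big_ord1.
  rewrite !coef_map /= expr0 mulr1 expr1.
  have -> : q`_1 = 1 by have := monicP qm; rewrite lead_coefE sq.
  by rewrite rmorph1 mul1r rmorphN /= addrC => /eqP; rewrite addr_eq0 => /eqP.
right; have qm_le := dvdp_leq p0 qmp.
(* As [q] has degree at least 2 and [q ^+ m] divides [p], of degree at most [2m], all these degree
   bounds are equalities; both being monic, [q ^+ m = p]. *)
have /andP[/eqP sq /eqP sp] : (size q == 3) && ((size p).-1 == m.*2).
  have sqm0 : (0 < size (q ^+ m)%R)%N by rewrite size_poly_gt0 expf_neq0.
  move: qm_le sqm0 pn q3 m0 sqm.
  move: (size (q ^+ m)%R) (size p) (size q) => e f [|[|[|g]]] //= qm_le sqm0 pn _ m0.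
  case: g => [|g] sqm; rewrite ?mulSn in sqm *; lia.
split=> //.
have pE : q ^+ m = p.
  apply/eqP; rewrite -eqp_monic ?monic_exp // -dvdp_size_eqp // eqn_leq qm_le.
  by move: sqm sp m0; rewrite sq mul2n; move: (size (q ^+ m)%R) (size p); lia.
have [q2 q2E] := factor_theorem _ _ qa.
have q2m : q2 \is monic by rewrite -(monicMr _ (monicXsubC a)) -q2E monic_map.
have sq2 : size q2 = 2.
  move: (size_map_poly (ratr : {rmorphism rat -> L}) q); rewrite sq q2E.
  by rewrite size_Mmonic ?monicXsubC ?monic_neq0 // size_XsubC addn2 => -[].
exists (- q2`_0); rewrite -pE rmorphXn /= q2E mulrC; congr ((_ * _) ^+ _).
apply/polyP => i; rewrite polyCN opprK coefD coefX coefC.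
case: i => [|[|i]]; rewrite ?add0r ?addr0 //=.
  by have := monicP q2m; rewrite lead_coefE sq2.
by rewrite nth_default // sq2.
Qed.
End MinPoly.

(** * Integrality of rational roots and multiplicity of eigenvalues *)

Lemma monic_int_rat_root (p : {poly int}) (c : rat) :
  p \is monic -> root (map_poly intr p) c -> exists z : int, c = z%:~R.
Proof.
move=> pm; rewrite -dvdp_XsubCl => /dvdpP_rat_int[p1 [a a0 XE] [r pE]].
(* By Gauss's lemma ['X - c%:P] is [a] times an integer divisor [p1] of [p]. Since [p] is monic, the
   leading coefficients of [p1] and [r] are mutually inverse, so [a] is an integer. *)
have u1 : (lead_coef r)%:~R * (lead_coef p1)%:~R = 1 :> rat.
  by rewrite -intrM mulrC -lead_coefM -pE (monicP pm).
have a1 : a * (lead_coef p1)%:~R = 1.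
  have := lead_coefXsubC c; rewrite XE lead_coefZ lead_coef_map_inj //.
  exact: intr_inj.
have aE : a = (lead_coef r)%:~R.
  have l0 : (lead_coef p1)%:~R != 0 :> rat.
    by apply: contraTneq (oner_neq0 rat) => l0; rewrite -a1 l0 mulr0 eqxx.
  by apply: (mulIf l0); rewrite a1 u1.
exists (- (lead_coef r * p1`_0)); have := congr1 (fun q : {poly rat} => q`_0) XE.
rewrite coefB coefX coefC coefZ coef_map /= sub0r aE => /eqP.
by rewrite eqr_oppLR => /eqP ->; rewrite -intrM -rmorphN.
Qed.

(** Sylvester's determinant identity: block elimination in [P] clears either the upper right or the
    lower left block, and the two resulting values of [\det P] are compared. *)
Lemma det_scalar_sub_mulmx (R : comNzRingType) n r (C : 'M[R]_(n, r))
    (B : 'M[R]_(r, n)) (z : R) :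
  \det (z%:M - C *m B) * z ^+ r = z ^+ n * \det (z%:M - B *m C).
Proof.
pose P := block_mx z%:M C B (1%:M : 'M_r).
have PE1 : \det P = \det (z%:M - C *m B).
  have := det_mulmx (block_mx 1%:M (- C) 0 1%:M) P.
  rewrite det_ublock !det1 !mul1r => <-; rewrite mulmx_block.
  rewrite !mul1mx !mul0mx !add0r !mulmx1 addrN mulNmx.
  by rewrite det_lblock det1 mulr1.
have := det_mulmx (block_mx 1%:M 0 (- B) z%:M) P.
rewrite det_lblock det1 mul1r det_scalar PE1 mulrC => <-; rewrite mulmx_block.
rewrite !mul1mx !mul0mx !addr0 !mulNmx mulmx1 mul_mx_scalar mul_scalar_mx.
by rewrite addNr det_ublock det_scalar addrC.
Qed.

(** A rank factorisation of [A - a%:M] turns [char_poly A] into the left determinant of Sylvester's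
    identity at [z = 'X - a%:P]; the power of [z] on the right is then a divisor. *)
Lemma geometric_multiplicity (F : fieldType) n (A : 'M[F]_n) (a : F) r :
  (\rank (A - a%:M)%R <= r)%N -> ('X - a%:P) ^+ (n - r) %| char_poly A.
Proof.
move=> rr; set M := A - a%:M in rr *; set z := 'X - a%:P.
apply: (@dvdp_trans _ (z ^+ (n - \rank M))); first exact/dvdp_exp2l/leq_sub2l.
have zr0 : z ^+ \rank M != 0 by rewrite expf_neq0 ?polyXsubC_eq0.
rewrite -(dvdp_mul2r _ _ zr0) -exprD subnK ?rank_leq_row //.
have -> : char_poly A = \det (z%:M - map_mx polyC (col_base M) *m map_mx polyC (row_base M)).
  rewrite -map_mxM mulmx_base; congr determinant.
  by rewrite /char_poly_mx /M /z map_mxB map_scalar_mx /= raddfB /= opprB addrA addrNK.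
by rewrite det_scalar_sub_mulmx dvdp_mulr.
Qed.

(** * Trace, rank and nilpotency of real matrices *)

Section RealMatrices.
Variable R : realFieldType.

Lemma mxtrace_mul_tr m n (A : 'M[R]_(m, n)) :
  \tr (A *m A^T) = \sum_i \sum_j A i j ^+ 2.
Proof.
by apply: eq_bigr => i _; rewrite mxE; apply: eq_bigr => j _; rewrite mxE expr2.
Qed.

Lemma mxtrace_mul_tr_ge0 m n (A : 'M[R]_(m, n)) : 0 <= \tr (A *m A^T).
Proof. by rewrite mxtrace_mul_tr; do 2!apply: sumr_ge0 => ? _; exact: sqr_ge0. Qed.

Lemma mul_tr_eq0 m n (A : 'M[R]_(m, n)) : A *m A^T = 0 -> A = 0.
Proof.
move=> A0; have : \tr (A *m A^T) = 0 by rewrite A0 mxtrace0.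
rewrite mxtrace_mul_tr => /eqP; rewrite psumr_eq0 => [/allP A0'|i _]; last first.
  by apply: sumr_ge0 => ? _; exact: sqr_ge0.
apply/matrixP => i j; rewrite mxE.
have := A0' i (mem_index_enum _); rewrite psumr_eq0 => [/allP /(_ j (mem_index_enum _))|? _].
  by rewrite sqrf_eq0 => /eqP.
exact: sqr_ge0.
Qed.

(* [P] below is the orthogonal projection onto the row space of [M]. *)
Lemma sqr_mxtrace_le_rank n (M : 'M[R]_n) :
  (\tr M) ^+ 2 <= (\rank M)%:R * \tr (M *m M^T).
Proof.
have := row_base_free M; have := mulmx_base M.
move: (col_base M) (row_base M) => C B MB Bfree.
set r := \rank M in C B MB Bfree *; pose G := B *m B^T.
(* The Gram matrix of independent rows is invertible: [v *m G = 0] makes the squared length of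
   [v *m B] vanish. *)
have Gu : G \in unitmx.
  rewrite -row_free_unit; apply: inj_row_free => v vG0.
  have vB0 : v *m B = 0.
    by apply: mul_tr_eq0; rewrite trmx_mul mulmxA -[v *m B *m _]mulmxA vG0 mul0mx.
  by apply: (row_free_inj Bfree); rewrite vB0 mul0mx.
pose P := B^T *m invmx G *m B.
have GT : G^T = G by rewrite trmx_mul trmxK.
have PT : P^T = P by rewrite !trmx_mul trmxK trmx_inv GT mulmxA.
have MP : M *m P = M.
  rewrite -{1}MB /P !mulmxA -[_ *m B *m B^T]mulmxA -/G.
  by rewrite mulmxK.
have PP : P *m P = P.
  by rewrite {1 2}/P !mulmxA -[_ *m B *m B^T]mulmxA -/G mulmxKV.
have trP : \tr P = r%:R.
  by rewrite /P mxtrace_mulC mulmxA mulmxV // mxtrace1.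
(* This is the squared Frobenius norm of [M - l *: P]; its minimum over [l], at [\tr M / r%:R], is
   the inequality sought. *)
have key (l : R) : 0 <= \tr (M *m M^T) - 2 * l * \tr M + l ^+ 2 * r%:R.
  have := mxtrace_mul_tr_ge0 _ _ (M - l *: P).
  have -> : (M - l *: P)^T = M^T - l *: P by rewrite linearB linearZ /= PT.
  rewrite mulmxBl !mulmxBr -!scalemxAl -!scalemxAr MP PP.
  rewrite -[P *m M^T]trmxK trmx_mul trmxK PT MP.
  rewrite !raddfB /= !linearZ /= mxtrace_tr trP; congr (0 <= _); ring.
have [r0|r0] := eqVneq r 0%N.
  by move/eqP: r0; rewrite mxrank_eq0 => /eqP ->;
    rewrite mxtrace0 expr0n /= mulr_ge0 // mxtrace_mul_tr_ge0.
have r0' : 0 < r%:R :> R by rewrite ltr0n lt0n.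
have := key (\tr M / r%:R); rewrite -(pmulr_rge0 _ r0').
rewrite [X in 0 <= X](_ : _ = r%:R * \tr (M *m M^T) - \tr M ^+ 2) ?subr_ge0 //.
by field; rewrite gt_eqF.
Qed.

(** The exponent is raised to a power of two and then halved repeatedly: for a symmetric power [T]
    of [S], [T ^+ 2] equals [T *m T^T], which vanishes only for [T = 0]. *)
Lemma sym_nilpotent_eq0 n (S : 'M[R]_n.+1) m : S^T = S -> S ^+ m = 0 -> S = 0.
Proof.
move=> ST Sm; have sX k : (S ^+ k)^T = S ^+ k.
  elim: k => [|k IH]; first by rewrite expr0 trmx1.
  by rewrite exprS -mulmxE trmx_mul ST IH mulmxE -exprSr exprS.
have : S ^+ (2 ^ m) = 0.
  by rewrite -(subnK (ltnW (ltn_expl m (isT : 1 < 2)%N))) exprD Sm mulr0.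
elim: m {Sm} => [|m IH]; first by rewrite expn0 expr1.
rewrite expnSr exprM expr2 => h; apply/IH/mul_tr_eq0.
by rewrite sX; exact: h.
Qed.
End RealMatrices.

(** * Eigenvalues of high multiplicity of integer matrices *)

Section IntegralMatrices.
Variable R : realFieldType.
Local Notation toR := (map_mx (intr : int -> R)).

(** The multiplicity of [a] is at least [n - r], hence at least half of the degree of the
    characteristic polynomial. A rational [a] is an integer because that polynomial is monic with
    integer coefficients. *)
Lemma integral_eigenvalue n (A : 'M[int]_n) (a : R) r :
    (r < n)%N -> (r.*2 <= n)%N -> (\rank (toR A - a%:M)%R <= r)%N ->
  (exists z : int, a = z%:~R) \/
  n = r.*2 /\ exists b, char_poly (toR A) = (('X - a%:P) * ('X - b%:P)) ^+ r.
Proof.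
move=> rn r2n /geometric_multiplicity.
pose AQ : 'M[rat]_n := map_mx intr A; pose p := char_poly AQ.
have pE : map_poly (ratr : rat -> R) p = char_poly (toR A).
  rewrite map_char_poly /AQ -map_mx_comp; congr char_poly.
  by apply/matrixP => i j; rewrite !mxE /= ratr_int.
have sp : (size p).-1 = n by rewrite size_char_poly.
rewrite -pE => dv.
have [||//|[c aE]|[nE [b bE]]] := half_multiplicity_root _ a p (n - r) (char_poly_monic _).
- by rewrite subn_gt0.
- by rewrite sp; lia.
- left; suff [z cE] : exists z : int, c = z%:~R by exists z; rewrite aE cE ratr_int.
  apply: (monic_int_rat_root (char_poly A)); first exact: char_poly_monic.
  rewrite map_char_poly -/AQ -/p -(fmorph_root (ratr : {rmorphism rat -> R})) /= -aE.
  rewrite -dvdp_XsubCl (dvdp_trans _ dv) // -(prednK (n := n - r)) ?subn_gt0 //.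
  by rewrite exprS dvdp_mulr.
- right; rewrite sp in nE; have nr : (n - r)%N = r by lia.
  by split; [lia | exists b; rewrite bE nr].
Qed.

(** In the exceptional case the trace is [r] times [a + b], so [b = - a]. By Cayley-Hamilton the
    symmetric matrix [A ^+ 2 - a ^+ 2] is then nilpotent, hence zero. *)
Lemma integral_eigenvalue_zero_trace n (A : 'M[int]_n.+1) (a : R) r :
    n.+1 = r.*2 -> A^T = A -> (\rank (toR A - a%:M)%R <= r)%N -> \tr A = 0 ->
  (exists z : int, a = z%:~R) \/ toR A *m toR A = (a ^+ 2)%:M.
Proof.
move=> nr AT rk tr0.
have [||//|[z zE]|[_ [b bE]]] := integral_eigenvalue _ A a r.
- by lia.
- by lia.
- by left; exists z.
right.
have ab : a + b = 0.
  have : (char_poly (toR A))`_(n.+1).-1 = 0.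
    by rewrite char_poly_trace // trace_map_mx /= tr0 oppr0.
  have -> : char_poly (toR A) = \prod_(x <- nseq r a ++ nseq r b) ('X - x%:P).
    by rewrite bE big_cat /= !big_nseq -!Monoid.iteropE /= exprMn.
  have -> : n.+1 = size (nseq r a ++ nseq r b) by rewrite size_cat !size_nseq nr addnn.
  rewrite coefPn_prod_XsubC; last by rewrite size_cat !size_nseq; lia.
  rewrite big_cat /= !big_nseq -!Monoid.iteropE /= => /eqP.
  rewrite oppr_eq0 -mulrnDl mulrn_eq0 => /orP[/eqP r0|/eqP //]; lia.
have {ab} bE' : b = - a by apply/eqP; rewrite -addr_eq0 addrC ab.
have hq : horner_mx (toR A) (('X - a%:P) * ('X - b%:P)) = toR A *m toR A - (a ^+ 2)%:M.
  rewrite rmorphM !rmorphB /= !horner_mx_X !horner_mx_C bE' -mulmxE.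
  rewrite raddfN /= opprK mulmxBl !mulmxDr mul_scalar_mx mul_mx_scalar -scalar_mxM expr2.
  by rewrite opprD addrA addrK.
apply/subr0_eq/(sym_nilpotent_eq0 _ _ _ r); last first.
  by rewrite -hq -[LHS]rmorphXn -bE; exact: Cayley_Hamilton.
by rewrite linearB /= trmx_mul tr_scalar_mx map_trmx AT.
Qed.

(** If the square of this adjacency matrix is the scalar [a ^+ 2], distinct vertices have no common
    neighbour, so every degree is at most 1. As [a ^+ 2] is the degree of a vertex, [a] is 0, 1 or
    -1. *)
Lemma graph_eigenvalue_half_multiplicity n (A : 'M[int]_n) (a : R) r :
    (0 < r)%N -> n = r.*2 -> A^T = A -> (forall i, A i i = 0) ->
    (forall i j, A i j = 0 \/ A i j = 1) -> (\rank (toR A - a%:M)%R <= r)%N ->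
  exists z : int, a = z%:~R.
Proof.
case: n A => [|n] A r0 nr AT A0 A01 rk; first by lia.
have trA : \tr A = 0 by rewrite /mxtrace big1.
have [//|A2] := integral_eigenvalue_zero_trace n A a r nr AT rk trA.
pose c := (A *m A) ord0 ord0.
have cE : a ^+ 2 = c%:~R.
  have /matrixP/(_ ord0 ord0) := A2.
  by rewrite -map_mxM mxE [RHS]mxE eqxx mulr1n => <-.
have off i j : i != j -> (A *m A) i j = 0.
  move=> ij; have /matrixP/(_ i j) := A2.
  by rewrite -map_mxM mxE [RHS]mxE (negPf ij) mulr0n => /eqP; rewrite intr_eq0 => /eqP.
have AS i j : A i j = A j i by rewrite -{1}AT mxE.
have Age i j : 0 <= A i j by case: (A01 i j) => ->.
(* Two neighbours of a vertex would have that vertex as common neighbour. *)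
have uniq_nb i j l : A i j = 1 -> A i l = 1 -> j = l.
  move=> ij il; apply/eqP/negPn/negP => /off; rewrite mxE => /eqP.
  rewrite psumr_eq0 => [/allP/(_ i (mem_index_enum _))|x _]; last exact: mulr_ge0.
  by rewrite AS ij il.
have : c = 0 \/ c = 1.
  have [[j ij]|none] := pselect (exists j, A ord0 j = 1).
    right; rewrite /c mxE (bigD1 j) //= (AS j) ij big1 ?addr0 // => l lj.
    case: (A01 ord0 l) => [->|il]; first by rewrite mul0r.
    by rewrite (uniq_nb _ _ _ il ij) eqxx in lj.
  left; rewrite /c mxE big1 // => l _.
  by case: (A01 ord0 l) => [->|il]; [rewrite mul0r | case: none; exists l].
case=> cv; move: cE; rewrite cv => /eqP.
  by rewrite sqrf_eq0 => /eqP ->; exists 0.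
by rewrite sqrf_eq1 => /orP[] /eqP ->; [exists 1 | exists (-1)].
Qed.
End IntegralMatrices.

(** * Homogeneous forms on a family of points and the rank they allow *)

Section Forms.
Variables (F : fieldType) (d : nat) (I : Type) (x : I -> 'I_d -> F).

(** Monomials are written as words in the variables, without identifying permuted words, so that
    multiplying by a coordinate only prepends a letter. *)
Definition is_form D (u : I -> F) := exists c : D.-tuple 'I_d -> F,
  forall p, u p = \sum_w c w * \prod_(i <- w) x p i.

Lemma is_form_ext D u v : u =1 v -> is_form D u -> is_form D v.
Proof. by move=> uv [c cE]; exists c => p; rewrite -uv. Qed.

Lemma is_form1 : is_form 0 (fun=> 1).
Proof.
exists (fun=> 1) => p; rewrite (bigD1 [tuple]) //= big_nil mulr1 big1 ?addr0 // => w.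
by case/eqP; apply/val_inj/size0nil; rewrite size_tuple.
Qed.

Lemma is_formD D u v : is_form D u -> is_form D v -> is_form D (fun p => u p + v p).
Proof.
move=> [c cE] [c' c'E]; exists (fun w => c w + c' w) => p.
by rewrite cE c'E -big_split; apply: eq_bigr => w _; rewrite mulrDl.
Qed.

Lemma is_formZ D a u : is_form D u -> is_form D (fun p => a * u p).
Proof.
move=> [c cE]; exists (fun w => a * c w) => p.
by rewrite cE mulr_sumr; apply: eq_bigr => w _; rewrite mulrA.
Qed.

Lemma is_form_sum D (J : finType) (u : J -> I -> F) :
  (forall j, is_form D (u j)) -> is_form D (fun p => \sum_j u j p).
Proof.
move=> uF; have [c cE] := fin_all_exists uF.
exists (fun w => \sum_j c j w) => p; under eq_bigr do rewrite cE.
by rewrite exchange_big; apply: eq_bigr => w _; rewrite mulr_suml.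
Qed.

Lemma is_form_coord D u i : is_form D u -> is_form D.+1 (fun p => x p i * u p).
Proof.
move=> [c cE].
exists (fun w : D.+1.-tuple 'I_d => (thead w == i)%:R * c [tuple of behead w]) => p.
rewrite cE mulr_sumr.
pose h (w : D.-tuple 'I_d) := [tuple of i :: w].
rewrite [RHS](bigID (fun w : D.+1.-tuple _ => thead w == i)) /=.
rewrite [X in _ + X]big1 ?addr0 => [|w /negPf ->]; last by rewrite !mul0r.
rewrite (reindex h) /=; last first.
  exists (fun w : D.+1.-tuple 'I_d => [tuple of behead w]) => w; first by move=> _; exact/val_inj.
  rewrite inE /h => /eqP <-.
  by case/tupleP: w => j t; apply/val_inj.
apply: eq_big => [w|w _]; first by rewrite eqxx.
rewrite eqxx mul1r big_cons mulrCA; congr (c _ * _).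
by apply: val_inj.
Qed.

Lemma is_form_linear D u (y : 'I_d -> F) :
  is_form D u -> is_form D.+1 (fun p => (\sum_i x p i * y i) * u p).
Proof.
move=> uF; apply: (is_form_ext _ (fun p => \sum_i y i * (x p i * u p))).
  by move=> p; rewrite mulr_suml; apply: eq_bigr => i _; rewrite mulrCA mulrA.
by apply: is_form_sum => i; apply/is_formZ/is_form_coord.
Qed.

(** Serves to homogenise: on the unit sphere the extra factor is 1, so the degree rises by 2 without
    changing the function. *)
Lemma is_form_normsq D u :
  is_form D u -> is_form D.+2 (fun p => (\sum_i x p i * x p i) * u p).
Proof.
move=> uF; apply: (is_form_ext _ (fun p => \sum_i x p i * (x p i * u p))).
  by move=> p; rewrite mulr_suml; apply: eq_bigr => i _; rewrite mulrA.
by apply: is_form_sum => i; do 2!apply: is_form_coord.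
Qed.
End Forms.
Arguments is_form {F d I} x D u.

(* Monomials only depend on the sorted list of their variables, and weakly increasing
   [D]-tuples in ['I_n.+1] are counted by ['C(D + n, D)]. *)
Lemma rank_forms (F : fieldType) n k D (x : 'I_k -> 'I_n.+1 -> F) (M : 'M[F]_k) :
  (forall q, is_form x D (M q)) -> (\rank M <= 'C(D + n, D))%N.
Proof.
move=> MF; have [c cE] := fin_all_exists MF.
pose T := [set t : D.-tuple 'I_n.+1 | sorted leq (map val t)].
pose le_ord : rel 'I_n.+1 := fun i j => (i <= j)%N.
pose st (w : D.-tuple 'I_n.+1) : D.-tuple 'I_n.+1 := [tuple of sort le_ord w].
have stT w : st w \in T.
  by rewrite inE sorted_map; apply: sort_sorted => i j; exact: leq_total.
(* [C] adds up the coefficients of words with the same sorted form, [S] evaluates the sorted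
   monomials; [M] factors through them. *)
pose C := \matrix_(q < k, t < #|T|) \sum_(w | st w == enum_val t) c q w.
pose S := \matrix_(t < #|T|, p < k) \prod_(i <- enum_val t) x p i.
suff -> : M = C *m S.
  by rewrite -card_sorted_tuples -/T (leq_trans (mxrankM_maxl _ _)) ?rank_leq_col.
apply/matrixP => q p; rewrite cE mxE.
rewrite (partition_big st [in T]) => [|w _]; last exact: stT.
rewrite big_enum_val /=; apply: eq_bigr => t _; rewrite !mxE mulr_suml.
apply: eq_bigr => w /eqP <-; congr (_ * _).
by apply: perm_big; rewrite perm_sym perm_sort.
Qed.

(** * Integrality and size of a constant diagonal under a rank bound *)

Lemma constant_diagonal_bound (R : realFieldType) n (M : 'M[R]_n.+1) a r :
    (forall i, M i i = a) -> (forall i j, i != j -> M i j ^+ 2 <= 1) ->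
    (\rank M <= r)%N ->
  (n.+1%:R - r%:R) * a ^+ 2 <= r%:R * n%:R.
Proof.
move=> Ma M1 rk; have trM : \tr M = n.+1%:R * a.
  by rewrite /mxtrace; under eq_bigr do rewrite Ma; rewrite sumr_const card_ord mulr_natl.
(* Each of the [n.+1] rows has squared length at most [a ^+ 2 + n]; one factor [n.+1] cancels in the
   trace inequality below. *)
have trMM : \tr (M *m M^T) <= n.+1%:R * (a ^+ 2 + n%:R).
  rewrite mxtrace_mul_tr [leRHS]mulr_natl -[n.+1 in leRHS]card_ord -sumr_const.
  apply: ler_sum => i _; rewrite (bigD1 i) //= Ma lerD2l.
  have /le_trans : \sum_(j < n.+1 | j != i) M i j ^+ 2 <= \sum_(j < n.+1 | j != i) 1.
    by apply: ler_sum => j ji; rewrite M1 // eq_sym.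
  by apply; rewrite sumr_const cardC1 card_ord.
have := sqr_mxtrace_le_rank _ _ M; rewrite trM.
have tr0 := mxtrace_mul_tr_ge0 _ _ _ M.
have rkR : (\rank M)%:R <= r%:R :> R by rewrite ler_nat.
move=> /le_trans/(_ (ler_wpM2r tr0 rkR))/le_trans/(_ (ler_wpM2l (ler0n _ _) trMM)).
rewrite exprMn expr2 -mulrA [r%:R * _]mulrCA ler_pM2l ?ltr0n //.
by rewrite mulrBl mulrDr lerBlDr addrC.
Qed.

Section RankConditions.
Variable R : realType.

Lemma integral_part n (M : 'M[R]_n) k :
    M^T = M -> (forall i, M i i = k) ->
    (forall i j, i != j -> exists z : int, M i j = z%:~R) ->
  exists A : 'M[int]_n, [/\ map_mx intr A = M - k%:M, A^T = A,
    forall i, A i i = 0 & forall i j, i != j -> M i j = (A i j)%:~R].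
Proof.
move=> MT Mk Mint.
pose A : 'M[int]_n := \matrix_(i, j) (if i == j then 0 else Num.floor (M i j)).
have AE i j : i != j -> M i j = (A i j)%:~R.
  by move=> ij; rewrite mxE (negPf ij); have [z ->] := Mint i j ij; rewrite intrKfloor.
exists A; split=> //.
- apply/matrixP => i j; rewrite mxE [RHS]mxE !mxE; have [->|ij] := eqVneq i j.
    by rewrite Mk subrr.
  by rewrite mulr0n subr0; have [z ->] := Mint i j ij; rewrite intrKfloor.
- by apply/matrixP => i j; rewrite !mxE eq_sym -{1}MT mxE.
- by move=> i; rewrite mxE eqxx.
Qed.

Lemma zero_one_matrix_diagonal N (M : 'M[R]_(N.*2)) k :
    (1 < N)%N -> M^T = M -> (forall i, M i i = k) ->
    (forall i j, i != j -> M i j = 0 \/ M i j = 1) -> (\rank M <= N)%N ->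
  exists z : int, k = z%:~R /\ `|z| <= U R N.
Proof.
move=> N1 MT Mk M01 rk.
have [|A [AM AT A0 AE]] := integral_part _ M k MT Mk.
  by move=> i j ij; case: (M01 _ _ ij) => ->; [exists 0 | exists 1].
have [||z kz] := graph_eigenvalue_half_multiplicity R _ A (- k) N (ltnW N1) erefl AT A0.
- move=> i j; have [->|ij] := eqVneq i j; first by left.
  by case: (M01 _ _ ij) => h; [left|right]; apply: (@intr_inj R); rewrite -AE // h.
- by rewrite AM raddfN /= opprK addrNK.
have {}kz : k = (- z)%:~R by rewrite rmorphN /= -kz opprK.
exists (- z); split=> //.
rewrite /U floor_ge_int intr_norm -kz.
case: N N1 M MT Mk M01 rk A AM AT A0 AE => [|[|N]] // _ M MT Mk M01 rk A AM AT A0 AE.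
(* [2 *: M - J] has diagonal [2 * k - 1] and off-diagonal entries 1 and -1; subtracting [J] costs at
   most one in rank. *)
pose J : 'M[R]_(N.+2.*2) := const_mx 1.
have rkJ : (\rank (2 *: M - J)%R <= N.+3)%N.
  have J1 : (\rank (- J)%R <= 1)%N.
    have -> : - J = const_mx (-1) *m (const_mx 1 : 'rV_(N.+2.*2)).
      by apply/matrixP => i j; rewrite !mxE big_ord1 !mxE mulr1.
    exact: leq_trans (mxrankM_maxl _ _) (rank_leq_col _).
  apply: (leq_trans (mxrank_add _ _)); rewrite -[N.+3]addn1.
  by apply: leq_add => //; exact: leq_trans (mxrank_scale _ _) _.
have h : (N.+2.*2%:R - N.+3%:R) * (2 * k - 1) ^+ 2 <= N.+3%:R * N.+1.*2.+1%:R :> R.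
  apply: (constant_diagonal_bound R _ (2 *: M - J)) rkJ => [i|i j ij].
    by rewrite !mxE Mk.
  by rewrite !mxE; case: (M01 _ _ ij) => ->; rewrite ?mulr0 ?mulr1; lra.
have -> : (2 * N.+2 - 2)%N = N.+1.*2 by lia.
(* [v] is one less than the rank bound [N.+2]; it is positive, so [h] can be divided by [4 * v] to
   bound [(k - 2^-1) ^+ 2]. *)
set v : R := N.+1%:R; have v0 : 0 < v by rewrite ltr0n.
have vE : [/\ N.+2%:R = v + 1, N.+3%:R = v + 2, N.+2.*2%:R = 2 * v + 2,
    N.+1.*2%:R = 2 * v & N.+1.*2.+1%:R = 2 * v + 1 :> R].
  have E3 : N.+3%:R = v + 2 by rewrite -[N.+3]addn2 -[N.+1]addn1 /v -!natrD; congr _%:R; lia.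
  split; rewrite ?E3 // /v -?[_.*2.+1]addn1 -?addnn ?natrD -?natr1; ring.
clearbody v; case: vE h => E2 E3 E22 E12 E121; rewrite E22 E3 E121 natrX E2 E12 => h.
have sq : (k - 2^-1) ^+ 2 <= (v + 1) ^+ 2 / (2 * v) + 4^-1.
  rewrite -subr_ge0
    (_ : _ - _ = ((v + 2) * (2 * v + 1) - (2 * v + 2 - (v + 2)) * (2 * k - 1) ^+ 2) / (4 * v)).
    by apply: divr_ge0; [rewrite subr_ge0 | apply: mulr_ge0 => //; exact: ltW].
  by field; exact: lt0r_neq0.
apply: (@le_trans _ _ (2^-1 + `|k - 2^-1|)).
  by rewrite -{1}[k](subrK 2^-1) addrC (le_trans (ler_normD _ _)) // ger0_norm // invr_ge0.
by rewrite lerD2l -sqrtr_sqr ler_wsqrtr.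
Qed.

Lemma signed_matrix_diagonal N (M : 'M[R]_(N.*2.+1)) k :
    M^T = M -> (forall i, M i i = k) ->
    (forall i j, i != j -> [\/ M i j = 0, M i j = 1 | M i j = -1]) ->
    (\rank M <= N)%N ->
  exists z : int, k = z%:~R /\ `|z| <= U2 R N.
Proof.
move=> MT Mk M01 rk.
have [|A [AM AT A0 AE]] := integral_part _ M k MT Mk.
  by move=> i j ij; case: (M01 _ _ ij) => ->; [exists 0 | exists 1 | exists (-1)].
have rkA : (\rank (map_mx intr A - (- k)%:M)%R <= N)%N.
  by rewrite AM raddfN /= opprK addrNK.
(* The exceptional case needs an even size, whereas [N.*2.+1] is odd. *)
have [||[z kz]|[]] := integral_eigenvalue R _ A (- k) N _ _ rkA; try lia.
have {}kz : k = (- z)%:~R by rewrite rmorphN /= -kz opprK.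
exists (- z); split=> //.
rewrite /U2 floor_ge_int intr_norm -kz.
have h : (N.*2.+1%:R - N%:R) * k ^+ 2 <= N%:R * N.*2%:R.
  apply: (constant_diagonal_bound R _ M) rk => // i j ij.
  by case: (M01 _ _ ij) => ->; rewrite ?sqrrN ?expr1n ?expr0n ?ler01.
rewrite -sqrtr_sqr ler_wsqrtr // ler_pdivlMr ?ltr0n ?addn1 // mulrC.
have -> : N.+1%:R = N.*2.+1%:R - N%:R :> R by rewrite -natrB; [congr _%:R | ]; lia.
by rewrite -mulnn mulnCA mul2n natrM.
Qed.
End RankConditions.

(** * Antipodal sets, inner products on the sphere and interpolation *)

Lemma antipodal_half (V : zmodType) (X : seq V) n :
    uniq X -> (forall x, x \in X -> - x \in X) -> (n.*2 <= size X)%N ->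
  exists y : 'I_n -> V, (forall i, y i \in X) /\
    forall i j, i != j -> y i != y j /\ y i != - y j.
Proof.
move=> uX aX nX.
suff [Y [YX YP YS]] : exists Y, [/\ {subset Y <= X},
    pairwise (fun u v => (u != v) && (u != - v)) Y & size Y = n].
  exists (fun i => nth 0 Y i); split=> [i|]; first by apply/YX/mem_nth; rewrite YS.
  have lt_case (i j : 'I_n) : (i < j)%N -> Y`_i != Y`_j /\ Y`_i != - Y`_j.
    by move=> ij; apply/andP/(pairwiseP 0 YP) => //; rewrite inE YS.
  move=> i j; rewrite -val_eqE neq_ltn => /orP[|/lt_case[ji ji']]; first exact: lt_case.
  by rewrite eq_sym eqr_oppLR in ji'; rewrite eq_sym.
elim: n X uX aX nX => [|n IH] X uX aX nX; first by exists [::].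
(* Choosing [x] and deleting [x] and [- x] leaves an antipodal set with at most two elements
   fewer. *)
case: X uX aX nX => [//|x X'] /[dup] uX; set X := x :: X' => uX' aX nX.
pose P := [pred z | (z == x) || (z == - x)].
have [||| Y [YX YP YS]] := IH [seq z <- X | ~~ P z].
- exact: filter_uniq.
- move=> z; rewrite !mem_filter /= !negb_or eqr_oppLR eqr_opp => /andP[/andP[-> ->] /aX].
  by [].
- have : (count P X <= 2)%N.
    apply: (@leq_trans (count_mem x X + count_mem (- x) X)).
      by rewrite -count_predUI leq_addr.
    by rewrite -[2%N]/(1 + 1)%N !count_uniq_mem // leq_add ?leq_b1.
  rewrite size_filter; have := count_predC P X; rewrite doubleS in nX.
  by move: (count P X) (size X) nX => ? ?; move: (count _ _); lia.
exists (x :: Y); split; last by rewrite /= YS.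
- by move=> z; rewrite inE => /predU1P[->|/YX]; [exact: mem_head | rewrite mem_filter => /andP[]].
- rewrite /= YP andbT; apply/allP => z /YX; rewrite mem_filter /= negb_or => /andP[/andP[zx zNx] _].
  by rewrite eq_sym zx -eqr_oppLR eq_sym zNx.
Qed.

Section Sphere.
Variables (R : realType) (d : nat).
Implicit Types u v : 'rV[R]_d.

Lemma inprodC u v : inprod u v = inprod v u.
Proof. by apply: eq_bigr => i _; rewrite mulrC. Qed.

Lemma inprod_eqN1 u v : inprod u u = 1 -> inprod v v = 1 -> inprod u v = -1 -> u = - v.
Proof.
move=> u1 v1 uv; have : inprod (u + v) (u + v) = 0.
  rewrite (_ : inprod _ _ = inprod u u + 2 * inprod u v + inprod v v); last first.
    rewrite /inprod mulr_sumr -!big_split /=; apply: eq_bigr => i _; rewrite !mxE; ring.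
  by rewrite u1 v1 uv; ring.
move/eqP; rewrite psumr_eq0 => [/allP h|i _]; last by rewrite -expr2 sqr_ge0.
apply/eqP; rewrite -addr_eq0; apply/eqP/rowP => i; rewrite [RHS]mxE.
by have := h i (mem_index_enum _); rewrite mulf_eq0 orbb => /eqP.
Qed.
End Sphere.

(** Each constant [a j] is multiplied by the squared norm of [y p], which is 1, so every factor
    becomes a quadratic form. *)
Lemma is_form_even_prod (R : realType) d (I : Type) (y : I -> 'rV[R]_d) (w : 'rV[R]_d)
    (s : seq nat) (a c : nat -> R) D u :
  (forall p, inprod (y p) (y p) = 1) -> is_form (fun p i => y p 0 i) D u ->
  is_form (fun p i => y p 0 i) (D + (size s).*2)
    (fun p => (\prod_(j <- s) ((inprod (y p) w ^+ 2 - a j) / c j)) * u p).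
Proof.
move=> y1 uF; elim: s => [|j s IH].
  by rewrite addn0; apply: is_form_ext uF => p; rewrite big_nil mul1r.
pose g p := \prod_(j <- s) ((inprod (y p) w ^+ 2 - a j) / c j) * u p; rewrite /= doubleS !addnS.
apply: (is_form_ext _ _ _ _ _ (fun p => (c j)^-1 * (inprod (y p) w * (inprod (y p) w * g p)
    + - a j * (inprod (y p) (y p) * g p)))).
  by move=> p; rewrite y1 big_cons /g; ring.
apply/is_formZ/is_formD; first by do 2!apply: is_form_linear.
by apply/is_formZ/is_form_normsq.
Qed.

Lemma orthogonal_unit_dim (R : realType) d (u v : 'rV[R]_d) :
  inprod u u = 1 -> inprod v v = 1 -> inprod u v = 0 -> (1 < d)%N.
Proof.
case: d u v => [|[|d]] // u v.
  by rewrite /inprod big_ord0 => /eqP; rewrite eq_sym oner_eq0.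
rewrite /inprod !big_ord1 => u1 v1 /eqP; rewrite mulf_eq0 => /orP[] /eqP h.
  by move: u1; rewrite h mul0r => /eqP; rewrite eq_sym oner_eq0.
by move: v1; rewrite h mul0r => /eqP; rewrite eq_sym oner_eq0.
Qed.

(** Lagrange interpolation at the nodes [b j], which will be the squares of the [beta j]; it yields
    the off-diagonal entries. *)
Lemma lagrange_prod (F : fieldType) (b : nat -> F) (r : seq nat) i l :
    {in r, forall j, j != i -> b i != b j} -> l \in r ->
  \prod_(j <- r | j != i) ((b l - b j) / (b i - b j)) = (l == i)%:R.
Proof.
move=> bi lr; have [->|li] := eqVneq l i.
  rewrite big_seq_cond big1 // => j /andP[jr ji].
  by rewrite divff // subr_eq0 bi.
by apply/eqP; rewrite prodf_seq_eq0; apply/hasP; exists l; rewrite // li subrr mul0r eqxx.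
Qed.

Lemma size_iota_neq a n i : (a <= i < a + n)%N ->
  size [seq j <- iota a n | j != i] = n.-1.
Proof.
move=> ir; rewrite -[in RHS](size_iota a n) -(size_rem (x := i)) ?mem_iota //.
by rewrite rem_filter ?iota_uniq.
Qed.

Lemma distinct_squares (R : realType) (beta : nat -> R) n : beta 1%N = 0 ->
    uniq ([:: -1; 0] ++ [seq beta i | i <- iota 2 n]
                     ++ [seq - beta i | i <- iota 2 n]) ->
  (forall i, (2 <= i <= n.+1)%N -> beta i != 0) /\
  forall i j, (1 <= i <= n.+1)%N -> (1 <= j <= n.+1)%N -> j != i ->
    beta i ^+ 2 != beta j ^+ 2.
Proof.
move=> b1; rewrite cat_uniq => /and3P[_ /hasPn h0]; rewrite cat_uniq => /and3P[up /hasPn hN _].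
have in_iota i : (2 <= i <= n.+1)%N -> i \in iota 2 n by rewrite mem_iota; lia.
have b0 i : (2 <= i <= n.+1)%N -> beta i != 0.
  move=> ir; have /h0 : beta i \in map beta (iota 2 n) ++ map (fun i => - beta i) (iota 2 n).
    by rewrite mem_cat map_f ?in_iota.
  by rewrite !inE negb_or => /andP[].
split=> // i j ir jr ji; rewrite eqf_sqr negb_or.
have [i1|i1] := eqVneq i 1%N.
  by rewrite i1 b1 eq_sym [0 == - _]eq_sym oppr_eq0 b0 //; lia.
have [j1|j1] := eqVneq j 1%N; first by rewrite j1 b1 oppr0 b0 //; lia.
have ir2 : (2 <= i <= n.+1)%N by lia.
have jr2 : (2 <= j <= n.+1)%N by lia.
apply/andP; split.
  have nthE l : (2 <= l <= n.+1)%N -> beta l = nth 0 (map beta (iota 2 n)) (l - 2).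
    by move=> lr; rewrite (nth_map 0%N) ?size_iota ?nth_iota ?subnKC //; lia.
  rewrite (nthE i) // (nthE j) // nth_uniq ?size_map ?size_iota //; lia.
have /hN /= : - beta j \in map (fun i => - beta i) (iota 2 n).
  by apply: (map_f (fun i => - beta i)); exact: in_iota.
by apply: contraNneq => <-; rewrite map_f ?in_iota.
Qed.

(** * The two interpolation matrices on half of an antipodal set *)

Theorem theorem5p3 (R : realType) (d s : nat) (X : seq 'rV[R]_d)
    (beta : nat -> R) :
  (4 <= s)%N -> ~~ odd s ->
  uniq X -> on_unit_sphere X -> antipodal X -> s_distance_set X s ->
  beta 1%N = 0 ->
  (* B(X) = {-1, beta_1 = 0, +-beta_2, ..., +-beta_{s/2}} *)
  (forall t : R, in_B X t <->
     (t = -1 \/ exists2 i : nat, (1 <= i <= s./2)%N & (t = beta i \/ t = - beta i))) ->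
  (* ... and this set has exactly s elements *)
  uniq ([:: -1; 0] ++ [seq beta i | i <- iota 2 (s./2).-1]
                   ++ [seq - beta i | i <- iota 2 (s./2).-1]) ->
  (* part (1) *)
  ((4 * 'C(d + s - 3, s - 2) <= size X)%N ->
     forall i : nat, (1 <= i <= s./2)%N ->
       exists z : int, k1 beta s./2 i = z%:~R /\ `|z| <= U R 'C(d + s - 3, s - 2))
  /\
  (* part (2) *)
  ((4 * 'C(d + s - 4, s - 3) + 2 <= size X)%N ->
     forall i : nat, (2 <= i <= s./2)%N ->
       exists z : int, k2 beta s./2 i = z%:~R /\ `|z| <= U2 R 'C(d + s - 4, s - 3)).
Proof.
move=> s4 /negPf os uX sX aX _ b1 BX ub.
have [m [sE m2]] : exists m, s = m.*2 /\ (2 <= m)%N.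
  by exists s./2; have := odd_double_half s; rewrite os; lia.
move: BX ub; rewrite sE doubleK => BX.
have mS : m.-1.+1 = m by lia.
move=> /(distinct_squares _ _ _ b1); rewrite mS => -[b0 bsq].
have d1 : (1 < d)%N.
  have [x [y [xX yX _ xy]]] : in_B X 0 by apply/BX; right; exists 1%N; [lia | left].
  by apply: orthogonal_unit_dim xy; exact: sX.
case: d d1 X uX sX aX BX => [|[|n]] // _ X uX sX aX BX.
(* Inner product -1 would make two chosen points antipodal, so only the values [beta l] and
   [- beta l] remain. *)
have ips k (y : 'I_k -> _) : (forall i, y i \in X) ->
    (forall i j, i != j -> y i != y j /\ y i != - y j) ->
    forall p q, p != q -> exists2 l, (1 <= l <= m)%N &
      (inprod (y p) (y q) = beta l \/ inprod (y p) (y q) = - beta l).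
  move=> yX yy p q /yy[pq pNq].
  have /BX[h|//] : in_B X (inprod (y p) (y q)) by exists (y p), (y q).
  by case/eqP: pNq; apply: inprod_eqN1 h; exact: sX.
split=> szX i ir.
- have DE : (n.+2 + m.*2 - 3 = (m.*2 - 2) + n.+1)%N by lia.
  rewrite {}DE in szX *; set N := 'C(_, _) in szX *.
  have N1 : (1 < N)%N.
    (* Since the dimension is at least 2, [N] is at least the number [m.*2 - 1] of binary monomials
       of degree [m.*2 - 2]. *)
    apply: (@leq_trans 'C((m.*2 - 2).+1, m.*2 - 2)); first by rewrite binSn; lia.
    by rewrite leq_bin2l // -addn1 leq_add2l.
  have [|y [yX yy]] := antipodal_half _ X N.*2 uX aX; first by apply: leq_trans szX; lia.
  have y1 p : inprod (y p) (y p) = 1 by exact: sX.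
  pose M : 'M[R]_(N.*2) := \matrix_(q, p) \prod_(j <- iota 1 m | j != i)
    ((inprod (y p) (y q) ^+ 2 - beta j ^+ 2) / (beta i ^+ 2 - beta j ^+ 2)).
  apply: (zero_one_matrix_diagonal _ _ M).
  + exact: N1.
  + by apply/matrixP => p q; rewrite !mxE inprodC.
  + by move=> p; rewrite mxE y1 expr1n.
  + move=> p q /(ips _ _ yX yy)[l lr pq]; rewrite mxE inprodC.
    have -> : inprod (y p) (y q) ^+ 2 = beta l ^+ 2 by case: pq => ->; rewrite ?sqrrN.
    rewrite (lagrange_prod _ (fun j => beta j ^+ 2)); first by case: eqP; [right|left].
      by move=> j; rewrite mem_iota => jr; apply: bsq => //; lia.
    by rewrite mem_iota; lia.
  + apply: (rank_forms _ _ _ _ (fun p i => y p 0 i)) => q.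
    have -> : (m.*2 - 2)%N = (0 + (size [seq j <- iota 1 m | j != i]).*2)%N.
      by rewrite size_iota_neq; lia.
    have := is_form_even_prod R _ _ y (y q) [seq j <- iota 1 m | j != i]
      (fun j => beta j ^+ 2) (fun j => beta i ^+ 2 - beta j ^+ 2) _ _ y1 (is_form1 _ _ _ _).
    by apply: is_form_ext => p; rewrite mxE big_filter mulr1.
- have DE : (n.+2 + m.*2 - 4 = (m.*2 - 3) + n.+1)%N by lia.
  rewrite {}DE in szX *; set N := 'C(_, _) in szX *.
  have [|y [yX yy]] := antipodal_half _ X N.*2.+1 uX aX; first by apply: leq_trans szX; lia.
  have y1 p : inprod (y p) (y p) = 1 by exact: sX.
  pose M : 'M[R]_(N.*2.+1) := \matrix_(q, p) ((beta i)^-1 * inprod (y p) (y q) *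
    \prod_(j <- iota 2 m.-1 | j != i)
      ((inprod (y p) (y q) ^+ 2 - beta j ^+ 2) / (beta i ^+ 2 - beta j ^+ 2))).
  apply: (signed_matrix_diagonal _ _ M).
  + by apply/matrixP => p q; rewrite !mxE inprodC.
  + by move=> p; rewrite mxE y1 expr1n mulr1.
  + move=> p q /(ips _ _ yX yy)[l lr pq]; rewrite mxE inprodC.
    (* The node [beta 1 = 0] is absent from the product; there the linear factor makes the entry
       vanish. *)
    have [l1|l1] := eqVneq l 1%N.
      by constructor 1; move: pq; rewrite l1 b1 oppr0 => -[] ->; rewrite mulr0 mul0r.
    have -> : inprod (y p) (y q) ^+ 2 = beta l ^+ 2 by case: pq => ->; rewrite ?sqrrN.
    rewrite (lagrange_prod _ (fun j => beta j ^+ 2)).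
    * have [li|_] := eqVneq l i; last by constructor 1; rewrite mulr0.
      have bi0 := b0 i ir.
      by case: pq => ->; rewrite li mulr1 ?mulrN mulVf //; [constructor 2|constructor 3].
    * by move=> j; rewrite mem_iota => jr; apply: bsq => //; lia.
    * by rewrite mem_iota; lia.
  + apply: (rank_forms _ _ _ _ (fun p i => y p 0 i)) => q.
    (* One degree comes from the linear factor, two from each of the [m - 2] quadratic ones. *)
    have -> : (m.*2 - 3)%N = (1 + (size [seq j <- iota 2 m.-1 | j != i]).*2)%N.
      by rewrite size_iota_neq; lia.
    have /(is_form_even_prod R _ _ y (y q) [seq j <- iota 2 m.-1 | j != i]
      (fun j => beta j ^+ 2) (fun j => beta i ^+ 2 - beta j ^+ 2) _ _ y1) :=
      is_formZ _ _ _ _ _ (beta i)^-1 _ (is_form_linear _ _ _ _ _ _ (y q 0)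
        (is_form1 _ _ _ (fun p i => y p 0 i))).
    by apply: is_form_ext => p; rewrite mxE big_filter mulr1 mulrC.
Qed.
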